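(* The following two statements are equivalent. (i) (Duffin-Schaeffer conjecture) For every function $\psi:\mathbb{N}\to[0,\infty)$, if $\sum_{n=1}^{\infty}\frac{\psi(n)\varphi(n)}{n}=\infty$, then $\lambda(W(\psi))=1$. (ii) There exists a universal constant $C>0$ such that for every function $\psi:\mathbb{N}\to[0,\infty)$, $$\lambda(Z(\psi))\geq C\min\Big\{\sum_{n=1}^{\infty}\frac{\psi(n)\varphi(n)}{n},\,1\Big\}.$$
   Context: $\mathbb{N}$ is the set of positive integers, $\varphi$ is the Euler phi function, and $\lambda$ is the Lebesgue measure on $\mathbb{R}/\mathbb{Z}$ (total mass 1). For a function $\psi:\mathbb{N}\to[0,\infty)$ and $n\in\mathbb{N}$, define the subset of $\mathbb{R}/\mathbb{Z}$ $$\mathcal{E}_n(\psi)=\bigcup_{1\le m\le n,\ (m,n)=1}\Big(\frac{m-\psi(n)}{n},\frac{m+\psi(n)}{n}\Big)$$ (intervals taken modulo $1$; $(m,n)$ under the union is the gcd). Set $$W(\psi)=\bigcap_{m=1}^{\infty}\bigcup_{n=m}^{\infty}\mathcal{E}_n(\psi),\qquad Z(\psi)=\bigcup_{n=1}^{\infty}\mathcal{E}_n(\psi).$$ *)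

(* Defs.v *)
From HB Require Import structures.
From mathcomp Require Import all_boot all_order all_algebra.
From mathcomp Require Import all_classical all_reals all_analysis.
Set Implicit Arguments.
Unset Strict Implicit.
Unset Printing Implicit Defensive.
Import Order.TTheory GRing.Theory Num.Theory.
Import numFieldNormedType.Exports.
Local Open Scope classical_set_scope.
Local Open Scope ring_scope.

(* The circle R/Z is modelled by its fundamental domain [0, 1[; the quotient
   map R -> R/Z is then the fractional part. *)
Definition circle_proj (R : realType) (x : R) : R := x - (Num.floor x)%:~R.

Definition circle_measure (R : realType) (A : set R) : \bar R :=
  lebesgue_measure (A `&` `[0, 1[).

(* A function on the positive integers is a function on nat whose value at 0
   is never used. *)
Definition approx_set (R : realType) (psi : nat -> R) (n : nat) : set R :=
  \bigcup_(m in [set m : nat | (1 <= m <= n)%N /\ coprime m n])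
    (@circle_proj R @` `](m%:R - psi n) / n%:R, (m%:R + psi n) / n%:R[).

Definition limsup_approx (R : realType) (psi : nat -> R) : set R :=
  \bigcap_(m in [set m : nat | (1 <= m)%N])
    \bigcup_(n in [set n : nat | (m <= n)%N]) approx_set psi n.

Definition union_approx (R : realType) (psi : nat -> R) : set R :=
  \bigcup_(n in [set n : nat | (1 <= n)%N]) approx_set psi n.

Definition DS_sum (R : realType) (psi : nat -> R) : \bar R :=
  (\sum_(1 <= n <oo) (psi n * (totient n)%:R / n%:R)%:E)%E.

(* Main.v *)
(** Lift everything to 1-periodic subsets of the line.  Two
    observations on reduced fractions drive the two directions: multiplication
    by 2^j maps E_(2^j n) into E_n (dilation), and, if 2^k exactly divides n,
    then x |-> 2x + 2^-k maps E_n(psi) into E_n(2 psi) (expansion).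

    (i) => (ii): if (ii) fails, some psi has lambda(Z(psi)) tiny compared with
    min(sum, 1).  Dilation by powers of 2 yields copies of a truncation of psi
    with disjoint supports, no larger Z and at least half the sum; about 1/sum
    of them form a block of total mass bounded below and tiny Z.  Concatenating
    blocks with summable measures contradicts (i) by Borel-Cantelli.

    (ii) => (i): (ii) applied to tails gives lambda(W(psi)) >= C whenever the
    series diverges.  This is upgraded to lambda(W /\ I) >= C |I| for all
    intervals I of length 2^-j, which suffices by Lebesgue's density theorem.
    If the subseries over some class 2^k || n diverges, the intersection of the
    W(psi / 2^i) over that class is mapped into itself by x |-> 2x + 2^-k, hence
    is equidistributed among these intervals; otherwise the subseries over
    2^(j+1) | n diverges for every j, and its W is 2^-j-periodic. *)
Require Import Defs.
From HB Require Import structures.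
From mathcomp Require Import all_boot all_order all_algebra.
From mathcomp Require Import all_classical all_reals all_analysis.
From mathcomp Require Import measurable_realfun ring lra zify.
Set Implicit Arguments.
Unset Strict Implicit.
Unset Printing Implicit Defensive.
Import Order.TTheory GRing.Theory Num.Theory.
Import numFieldNormedType.Exports.
Local Open Scope classical_set_scope.
Local Open Scope ring_scope.

(** * Lebesgue measure under increasing affine maps *)

Section lebesgue_measure_affine.
Context {R : realType} (a b : R).
Hypothesis a0 : 0 < a.
Local Notation mu := (@lebesgue_measure R).

Let f (x : measurableTypeR R) : measurableTypeR R := a * x + b.

Lemma measurable_affine : measurable_fun setT f.
Proof. exact: measurable_funD. Qed.

Let nu (B : set (measurableTypeR R)) := (a%:E * pushforward mu f B)%E.

Let nu0 : nu set0 = 0%E.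
Proof. by rewrite /nu /pushforward preimage_set0 measure0 mule0. Qed.

Let nu_ge0 B : (0 <= nu B)%E.
Proof. by apply: mule_ge0; [rewrite lee_fin ltW|exact: (measure_ge0 mu)]. Qed.

Let nu_sigma_additive : semi_sigma_additive nu.
Proof.
move=> F mF tF mUF; rewrite /nu.
have -> : (fun n => \sum_(0 <= i < n) a%:E * pushforward mu f (F i))%E =
    (fun n => a%:E * \sum_(0 <= i < n) pushforward mu f (F i))%E.
  by apply/funext => n; rewrite ge0_sume_distrr// => i _; exact: (measure_ge0 mu).
apply: cvgeZl => //.
have mfF n : measurable (f @^-1` F n).
  by rewrite -[X in measurable X]setTI; exact: measurable_affine.
rewrite /pushforward preimage_bigcup.
apply: (@measure_semi_sigma_additive _ _ _ mu) => //.
  apply/trivIsetP => /= i j _ _ ij; rewrite -preimage_setI.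
  by move/trivIsetP : tF => /(_ _ _ _ _ ij) -> //; rewrite preimage_set0.
exact: bigcup_measurable.
Qed.

HB.instance Definition _ := isMeasure.Build _ _ _ nu nu0 nu_ge0 nu_sigma_additive.

(** Uniqueness of Lebesgue measure: the preimage of ]u, v] under [f] is an interval of length (v -
    u) / a, so [nu] gives ]u, v] its length. *)
Let lebesgue_measure_affine_image (B : set R) : measurable B ->
  mu B = (a%:E * mu [set x | B (a * x + b)%R])%E.
Proof.
move=> mB; apply: (@lebesgue_measure_unique R nu) => // _ [[u v]] _ <-.
rewrite [RHS]/(a%:E * mu (f @^-1` `]u, v]%classic))%E.
have -> : f @^-1` `]u, v]%classic = `](u - b) / a, (v - b) / a]%classic.
  apply/seteqP; split => x /=; rewrite !in_itv/= /f ltr_pdivrMr// ler_pdivlMr//;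
    by rewrite ltrBlDr lerBrDr mulrC.
rewrite !lebesgue_measure_itv/= !lte_fin ltr_pM2r ?invr_gt0// ltrD2r.
case: ifP => _ /=; last by rewrite mulr0.
by congr EFin; field; rewrite gt_eqF.
Qed.

Lemma lebesgue_measure_affine (B : set R) : measurable B ->
  mu [set x | B (a * x + b)] = (a^-1%:E * mu B)%E.
Proof.
move=> mB; rewrite (lebesgue_measure_affine_image mB) muleA -EFinM.
by rewrite mulVf ?mul1e// gt_eqF.
Qed.

End lebesgue_measure_affine.

(** * Equidistribution of periodic and of expanding-invariant sets *)

Section periodic_measure.
Context {R : realType}.
Implicit Types (A B : set R) (a b c h p x t : R).
Local Notation mu := (@lebesgue_measure R).

Lemma measurable_preimage_mul B a : measurable B -> measurable [set x | B (a * x)].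
Proof.
move=> mB; rewrite -[X in measurable X]setTI.
exact: (@mulrl_measurable R setT a measurableT B mB).
Qed.

Lemma measure_setI_itv_split B a b c : measurable B -> a <= b -> b <= c ->
  mu (B `&` `[a, c[) = (mu (B `&` `[a, b[) + mu (B `&` `[b, c[))%E.
Proof.
move=> mB ab bc; rewrite -measureU//=; [|exact: measurableI|exact: measurableI|].
  rewrite -setIUr; congr (mu (_ `&` _)); apply/seteqP; split => x /=;
    rewrite !in_itv/=; last by case=> /andP[]; lra.
  by case: (ltP x b) => xb; move=> /andP[]; [left|right]; lra.
by apply/seteqP; split => x //= [[_ +] [_]]; rewrite /= !in_itv/=; lra.
Qed.

Lemma measure_setI_itv_lty B a b : measurable B -> (mu (B `&` `[a, b[) < +oo)%E.
Proof.
move=> mB; apply: (@le_lt_trans _ _ (mu `[a, b[)).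
  by apply: le_measure; rewrite ?inE//; exact: measurableI.
by rewrite lebesgue_measure_itv/=; case: ifP => _; rewrite ?ltry.
Qed.

Lemma measure_periodic_shift B h a b : measurable B ->
  (forall x, B (x + h) <-> B x) ->
  mu (B `&` `[a + h, b + h[) = mu (B `&` `[a, b[).
Proof.
move=> mB Bh; rewrite -[LHS]mul1e -[in LHS](@invr1 R) -(@lebesgue_measure_affine R 1 h)//; last exact: measurableI.
congr (mu _); apply/seteqP; split => x /=; rewrite mul1r !in_itv/= !lerD2r !ltrD2r;
  by case=> /Bh.
Qed.

Lemma periodic_int B (z : int) x : (forall x, B (x + 1) <-> B x) ->
  B (x + z%:~R) <-> B x.
Proof.
move=> B1; have Bn (n : nat) y : B (y + n%:R) <-> B y.
  elim: n y => [|n IH] y; first by rewrite addr0.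
  by rewrite -natr1 addrA B1.
case: z => n; first exact: Bn.
by rewrite NegzE mulrNz -(Bn n.+1) subrK.
Qed.

(** Once an integer shift has brought t into [0, 1[, the piece over [1, t + 1[ is a translate of the
    missing piece over [0, t[. *)
Lemma measure_periodic_unit B t : measurable B ->
  (forall x, B (x + 1) <-> B x) ->
  mu (B `&` `[t, t + 1[) = mu (B `&` `[0, 1[).
Proof.
move=> mB B1.
wlog [t0 t1] : t / 0 <= t /\ t < 1.
  move=> H; have /andP[h1 h2] := floor_itv t.
  rewrite -(H (t - (Num.floor t)%:~R)); last by move: h1 h2; rewrite intrD; lra.
  rewrite -[RHS](@measure_periodic_shift _ (Num.floor t)%:~R)//; last first.
    by move=> x; exact: periodic_int.
  by rewrite subrK (addrAC _ 1) subrK.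
rewrite (@measure_setI_itv_split B t 1) ?(ltW t1)//; last by lra.
rewrite (@measure_setI_itv_split B 0 t 1) ?(ltW t1)//.
rewrite addeC; congr (_ + _)%E.
by rewrite -(@measure_periodic_shift B 1 0 t)// add0r.
Qed.

(** Two adjacent halves total 2 * p and neither exceeds p, so an upper bound alone already forces
    equality. *)
Lemma measure_halves B h p : measurable B -> 0 <= h ->
  (forall a, mu (B `&` `[a, a + 2 * h[) = (2 * p)%:E) ->
  (forall a, (mu (B `&` `[a, (a + h)%R[) <= p%:E)%E) ->
  forall a, mu (B `&` `[a, a + h[) = p%:E.
Proof.
move=> mB h0 B2h Bh a; apply/eqP; rewrite eq_le Bh/=.
have := B2h a; rewrite (@measure_setI_itv_split B a (a + h)) ?lerDl//; last by lra.
have -> : a + 2 * h = a + h + h by lra.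
move: (Bh (a + h)) (Bh a) (measure_setI_itv_lty a (a + h) mB) 
  (measure_setI_itv_lty (a + h) (a + h + h) mB).
have := measure_ge0 mu (B `&` `[a, a + h[).
have := measure_ge0 mu (B `&` `[a + h, a + h + h[).
case: (mu _) => [u| |]; case: (mu _) => [v| |]//=.
rewrite !lee_fin => _ _ vp up _ _ [uv]; lra.
Qed.

(** Induction on j. The map x |-> 2 * x + c sends the part of B in an interval of length 2^-(j+1)
    into the part of B in one of length 2^-j, and it doubles measure. This bounds every half from
    above, and [measure_halves] concludes. *)
Lemma measure_expanding B c p : measurable B -> (forall x, B (x + 1) <-> B x) ->
  (forall x, B x -> B (2 * x + c)) -> mu (B `&` `[0, 1[) = p%:E ->
  forall (j : nat) a, mu (B `&` `[a, a + 2^-1 ^+ j[) = (p * 2^-1 ^+ j)%:E.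
Proof.
move=> mB B1 Bc Bp; elim=> [|j IH] a.
  by rewrite expr0 mulr1 measure_periodic_unit.
apply: measure_halves => // {}a.
  rewrite exprS (_ : 2 * _ = 2^-1 ^+ j); last by lra.
  by rewrite IH; congr EFin; field.
apply: (@le_trans _ _ (mu [set x | (B `&` `[2 * a + c, 2 * a + c + 2^-1 ^+ j[) (2 * x + c)%R])).
  apply: le_measure; rewrite ?inE; first exact: measurableI.
    rewrite -[X in measurable X]setTI.
    by apply: (@measurable_affine R 2 c) => //; exact: measurableI.
  move=> x [/Bc Bx /=]; rewrite !in_itv/= exprS => xa; split => //; lra.
rewrite (@lebesgue_measure_affine R 2 c)//; last exact: measurableI.
by rewrite IH lee_fin exprS; lra.
Qed.

(** Each halving cuts an interval into two translates by a period of B, which share the measure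
    equally. *)
Lemma measure_periodic_pow2 B (j : nat) p : measurable B ->
  (forall (i : nat) x, (i <= j)%N -> B (x + 2^-1 ^+ i) <-> B x) ->
  mu (B `&` `[0, 1[) = p%:E ->
  forall (i : nat), (i <= j)%N ->
  forall a, mu (B `&` `[a, a + 2^-1 ^+ i[) = (p * 2^-1 ^+ i)%:E.
Proof.
move=> mB BP Bp; elim=> [|i IH] ij a.
  rewrite expr0 mulr1 measure_periodic_unit// => x.
  by rewrite -{1}[1](expr0 2^-1); exact: BP.
have r0 : 0 <= 2^-1 ^+ i :> R by rewrite exprn_ge0// invr_ge0.
have := IH (ltnW ij) a.
rewrite (@measure_setI_itv_split B a (a + 2^-1 ^+ i.+1))//; [|rewrite exprS; lra..].
have -> : a + 2^-1 ^+ i = (a + 2^-1 ^+ i.+1) + 2^-1 ^+ i.+1 by rewrite exprS; lra.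
rewrite measure_periodic_shift//; last by move=> x; exact: BP.
have /fineK <- : mu (B `&` `[a, a + 2^-1 ^+ i.+1[) \is a fin_num.
  by rewrite ge0_fin_numE// measure_setI_itv_lty.
by rewrite -EFinD => -[uv]; congr EFin; rewrite [in RHS]exprS; lra.
Qed.

(** The preimage under doubling has period 1/2, and on [0, 1/2[ it is a copy of B scaled by one
    half. *)
Lemma measure_double B : measurable B -> (forall x, B (x + 1) <-> B x) ->
  mu ([set x | B (2 * x)] `&` `[0, 1[) = mu (B `&` `[0, 1[).
Proof.
move=> mB B1.
have mB2 := measurable_preimage_mul 2 mB.
rewrite (@measure_setI_itv_split _ 0 2^-1); [|by []|lra|lra].
have -> : mu ([set x | B (2 * x)] `&` `[2^-1, 1[) = mu ([set x | B (2 * x)] `&` `[0, 2^-1[).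
  have E1 : 1 = 2^-1 + 2^-1 :> R by lra.
  rewrite -(@measure_periodic_shift [set x | B (2 * x)] 2^-1 0 2^-1)//; last first.
    by move=> x /=; rewrite mulrDr mulfV.
  by rewrite add0r -E1.
have -> : [set x | B (2 * x)] `&` `[0, 2^-1[ = [set x | (B `&` `[0, 1[) (2 * x + 0)].
  apply/seteqP; split => x /=; rewrite addr0 !in_itv/=; case=> Bx xx; split => //; lra.
rewrite (@lebesgue_measure_affine R 2 0)//; last exact: measurableI.
have /fineK <- : mu (B `&` `[0, 1[) \is a fin_num.
  by rewrite ge0_fin_numE// measure_setI_itv_lty.
by rewrite -EFinM -EFinD; congr EFin; lra.
Qed.

Lemma measure_pow2 B (j : nat) : measurable B -> (forall x, B (x + 1) <-> B x) ->
  mu ([set x | B (2 ^+ j * x)] `&` `[0, 1[) = mu (B `&` `[0, 1[).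
Proof.
move=> mB B1; elim: j => [|j IH].
  by congr (mu (_ `&` _)); apply/seteqP; split => x /=; rewrite expr0 mul1r.
rewrite -IH -[RHS]measure_double//; last 2 first.
- exact: measurable_preimage_mul.
- move=> x /=; rewrite mulrDr mulr1 -natrX; exact: (@periodic_int B (2 ^ j)%N).
by congr (mu (_ `&` _)); apply/seteqP; split => x /=; rewrite exprS mulrA (mulrC 2).
Qed.

(* By Lebesgue's density theorem almost every point outside B would be a
   density point of the complement. *)
Lemma measure_full_density B p : measurable B -> 0 < p ->
  (forall (j : nat) a, ((p * 2^-1 ^+ j)%:E <= mu (B `&` `[a, (a + 2^-1 ^+ j)%R[))%E) ->
  mu (B `&` `[0, 1[) = 1%E.
Proof.
move=> mB p0 Bp.
have [N [mN N0 BN]] : {ae mu, forall x, B x}.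
  have := lebesgue_density mB; apply: filter_app; first exact: (ae_filter_ringOfSetsType mu).
  apply: aeW => /= x /cvge_at_rightP /(_ (fun n => 2^-1 ^+ n)) xB.
  apply: contrapT => nBx.
  (* The ball of radius r = 2^-j around x has length 2 * r and contains a grid interval of length r,
     which meets B in measure at least p * r. Hence every density ratio is at least p / 2. *)
  have : ((p / 2)%:E <= (\1_B x)%:E)%E.
    apply: (cvge_ge _ (xB _)); last first.
      split; first by move=> n; rewrite exprn_gt0// invr_gt0.
      by apply: cvg_expr; rewrite ger0_norm ?invr_ge0//; lra.
    apply: nearW => j /=.
    have r0 : 0 < (2^-1 ^+ j : R) by rewrite exprn_gt0// invr_gt0.
    set r : R := 2^-1 ^+ j in r0 *.
    rewrite lebesgue_measure_ball; last exact: ltW.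
    rewrite inver mulrn_eq0/= gt_eqF//.
    have -> : (p / 2)%:E = ((p * r)%:E * ((r *+ 2)^-1)%:E)%E.
      by rewrite -EFinM; congr EFin; field; rewrite gt_eqF.
        apply: lee_wpmul2r; first by rewrite lee_fin invr_ge0 mulrn_wge0// ltW.
    have /andP[] := floor_itv (x / r); set z : R := (Num.floor _)%:~R.
    rewrite intrD ler_pdivlMr// ltr_pdivrMr// => h1 h2.
    apply: (le_trans (Bp j (z * r))); apply: le_measure; rewrite ?inE.
    - exact: measurableI.
    - by apply: measurableI => //; exact: measurable_ball.
    - move=> y [By] /=; rewrite in_itv/= -/r => /andP[h3 h4]; split => //.
      rewrite /ball/= ltr_norml.
      have dist (u v w s : R) : w * s <= u -> u < (w + 1) * s -> w * s <= v ->
        v < w * s + s -> - s < u - v < s by lra.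
      exact: dist h1 h2 h3 h4.
  rewrite indicE memNset// lee_fin mulr0n; lra.
have I1 : mu `[0, 1[ = 1%E by rewrite lebesgue_measure_itv/= lte01 oppr0 addr0.
apply/eqP; rewrite eq_le; apply/andP; split; rewrite -I1.
  by apply: le_measure; rewrite ?inE//; exact: measurableI.
rewrite -[leRHS]adde0 -N0.
apply: (le_trans _ (measureU2 _ _ _)) => //; last exact: measurableI.
apply: le_measure; rewrite ?inE//; first by apply: measurableU => //; exact: measurableI.
move=> x Ix; have [Bx|/BN Nx] := pselect (B x); [by left|by right].
Qed.

End periodic_measure.

(** * Coprimality of shifted and doubled numerators *)

Lemma coprimez_addM (m s d : int) : coprimez (m + s * d) d = coprimez m d.
Proof. by rewrite coprimez_sym /coprimez addrC gcdzMDl gcdzC. Qed.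

(** The shifted numerator stays coprime to d; as d is even it is odd, hence also coprime to 2^i. *)
Lemma coprimez_shift_pow2 (m s : int) (i d : nat) : (2 %| d)%N ->
  coprimez m (2 ^ i * d)%N -> coprimez (m + s * d%:Z) (2 ^ i * d)%N.
Proof.
move=> d2; rewrite !PoszM !coprimezMr => /andP[_ md].
have md' : coprimez (m + s * d%:Z) d by rewrite coprimez_addM.
by rewrite md' andbT; apply: coprimeXr; exact: coprime_dvdr d2 md'.
Qed.

(** Adding the odd d makes the doubled numerator odd, hence coprime to 2^k, without changing its
    class modulo d, where 2 * m is invertible. *)
Lemma coprimez_double_pow2 (m : int) (k d : nat) : odd d ->
  coprimez m (2 ^ k * d)%N -> coprimez (2 * m + d%:Z) (2 ^ k * d)%N.
Proof.
move=> d2; rewrite !PoszM !coprimezMr => /andP[_ md].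
apply/andP; split.
  have md2 : coprimez (2 * m + d%:Z) 2.
    by rewrite addrC mulrC coprimez_addM coprimezE /= coprimen2.
  exact: coprimeXr.
have := coprimez_addM (2 * m) 1 d; rewrite mul1r => ->.
by rewrite coprimezMl md andbT coprimezE /= coprime2n.
Qed.

(** * Lifting the approximation sets from the circle to the line *)

Section approximable.
Context {R : realType}.
Implicit Types (psi phi : nat -> R) (n m : nat) (x : R).
Local Notation mu := (@lebesgue_measure R).

(* The preimage of approx_set psi n under the projection of the line onto
   the circle, see approx_setE. *)
Definition approximable psi n : set R :=
  [set x | exists2 m : int, coprimez m n & `|x * n%:R - m%:~R| < psi n].

Lemma approx_setE psi n x : (0 < n)%N -> 0 <= x < 1 ->
  approx_set psi n x <-> approximable psi n x.
Proof.
move=> n0 x01; have n0' : 0 < n%:R :> R by rewrite ltr0n.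
split.
  case=> m [/andP[m0 mn] cmn] [y /=]; rewrite in_itv/= => /andP[].
  rewrite ltr_pdivrMr// ltr_pdivlMr// => h1 h2 yx.
  exists (m%:Z - Num.floor y * n%:Z).
    by rewrite -mulNr coprimez_addM coprimezE.
  rewrite -yx /circle_proj intrD mulrNz intrM /= -!pmulrn ltr_norml; lra.
case=> m cmn; rewrite ltr_norml => /andP[h1 h2].
(* Numerators on the circle run over 1, ..., n and not 0, ..., n - 1, so the division is applied to
   m - 1 and the representative is r + 1. *)
pose q := ((m - 1) %/ n%:Z)%Z; pose r := ((m - 1) %% n%:Z)%Z.
have mE : m - 1 = q * n%:Z + r by exact: divz_eq.
have r0 : 0 <= r by rewrite modz_ge0// -lt0n.
have rn : r < n%:Z by rewrite ltz_mod// -lt0n.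
have [k kE] : exists k : nat, r = k%:Z by exists `|r|%N; rewrite gez0_abs.
rewrite kE in mE r0 rn.
have mE' : m = k.+1%:Z + q * n%:Z by rewrite -addn1 PoszD; lra.
exists k.+1.
  split; first by rewrite ltz_nat in rn; rewrite /= rn.
  by move: cmn; rewrite mE' coprimez_addM coprimezE.
exists (x - q%:~R); last first.
  rewrite /circle_proj (_ : Num.floor _ = - q) ?mulrNz; first by lra.
  by apply/eqP; rewrite floor_eq intrD mulrNz; lra.
rewrite /= in_itv/= ltr_pdivrMr// ltr_pdivlMr//.
by move: h1 h2; rewrite mE' intrD intrM -!pmulrn; lra.
Qed.

Lemma circle_measure_limsup psi :
  circle_measure (limsup_approx psi) = mu (lim_sup_set (approximable psi) `&` `[0, 1[).
Proof.
congr (mu _); apply/seteqP; split => x [xA x01]; split => //.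
  (* Taking [m.+1] makes n positive, as [approx_setE] requires. *)
  move=> m _; have [n /= mn nx] := xA m.+1 isT.
  exists n => /=; first exact: ltnW.
  by apply/approx_setE; rewrite ?(leq_ltn_trans _ mn)//; move: x01; rewrite /= in_itv.
move=> m /= m0; have [n /= mn nx] := xA m I.
exists n => //; apply/approx_setE => //; exact: leq_trans mn.
Qed.

Lemma circle_measure_union psi :
  circle_measure (union_approx psi) =
  mu (\bigcup_(n in [set n : nat | (1 <= n)%N]) approximable psi n `&` `[0, 1[).
Proof.
congr (mu _); apply/seteqP; split => x [[n /= n0 nx] x01]; split => //; exists n => //;
  by apply/approx_setE => //; move: x01; rewrite /= in_itv.
Qed.

Lemma measurable_approximable psi n : measurable (approximable psi n).
Proof.
have -> : approximable psi n = \bigcup_(m in [set m : int | coprimez m n])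
    [set x : R | `]m%:~R - psi n, m%:~R + psi n[%classic (n%:R * x)].
  apply/seteqP; split => x.
    by case=> m mn; rewrite ltr_norml => h; exists m => //=; rewrite in_itv/=; lra.
  by case=> m mn /=; rewrite in_itv/= => h; exists m => //; rewrite ltr_norml; lra.
rewrite bigcup_mkcond; apply: countable_bigcupT_measurable => // m.
by case: ifP => _ //; exact: measurable_preimage_mul.
Qed.

Lemma measurable_limsup psi : measurable (lim_sup_set (approximable psi)).
Proof.
apply: bigcap_measurable => // k _; apply: bigcup_measurable => n _.
exact: measurable_approximable.
Qed.

Lemma measurable_bigcup_approximable psi (P : set nat) :
  measurable (\bigcup_(n in P) approximable psi n).
Proof. by apply: bigcup_measurable => n _; exact: measurable_approximable. Qed.

Lemma approximable1 psi n x : (0 < n)%N ->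
  approximable psi n (x + 1) <-> approximable psi n x.
Proof.
move=> n0; split=> -[m mn mx].
  exists (m + -1 * n%:Z); first by rewrite coprimez_addM.
  rewrite (_ : _ - _ = (x + 1) * n%:R - m%:~R)//.
  by rewrite intrD mulN1r mulrNz -pmulrn; ring.
exists (m + 1 * n%:Z); first by rewrite coprimez_addM.
rewrite (_ : _ - _ = x * n%:R - m%:~R)//.
by rewrite intrD mul1r -pmulrn; ring.
Qed.

End approximable.

(** * Shifts, doubling and dilation of approximation sets *)

Section approximable_maps.
Context {R : realType}.
Implicit Types (psi phi : nat -> R) (n m : nat) (x : R).

(** Shifting x by s / 2^i moves the numerator by s * (n / 2^i), where n / 2^i is even;
    [coprimez_shift_pow2] keeps the fraction reduced. *)
Lemma approximable_shift_pow2 psi n (i : nat) (s : int) x : (0 < n)%N ->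
  (2 ^ i.+1 %| n)%N -> approximable psi n x ->
  approximable psi n (x + s%:~R * 2^-1 ^+ i).
Proof.
move=> n0 /dvdnP[e nE] [m mn mx].
have {}nE : n = (2 ^ i * (2 * e))%N by rewrite nE expnS; lia.
exists (m + s * (2 * e)%N%:Z).
  by rewrite nE coprimez_shift_pow2 ?dvdn_mulr -?nE.
rewrite (_ : _ - _ = x * n%:R - m%:~R)// intrD intrM -pmulrn nE !natrM natrX.
have t0 : (2 : R) ^+ i != 0 by rewrite expf_neq0.
by rewrite exprVn; field.
Qed.

(** With d = n / 2^k odd, the new numerator is 2 * m + d, and the error is exactly doubled. *)
Lemma approximable_double psi n (k : nat) x : (2 ^ k %| n)%N ->
  ~~ (2 ^ k.+1 %| n)%N -> approximable psi n x ->
  approximable (fun n => 2 * psi n) n (2 * x + 2^-1 ^+ k).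
Proof.
move=> /dvdnP[d nE] ndvd [m mn mx].
have {}nE : n = (2 ^ k * d)%N by rewrite nE mulnC.
have d2 : odd d.
  apply: contraR ndvd; rewrite -dvdn2 => /dvdnP[e dE].
  by apply/dvdnP; exists e; rewrite nE dE expnS; lia.
exists (2 * m + d%:Z); first by rewrite nE coprimez_double_pow2 -?nE.
have -> : (2 * x + 2^-1 ^+ k) * n%:R - (2 * m + d%:Z)%:~R = 2 * (x * n%:R - m%:~R).
  rewrite intrD intrM -!pmulrn nE natrM natrX.
  have t0 : (2 : R) ^+ k != 0 by rewrite expf_neq0.
  by rewrite exprVn; field.
by rewrite normrM ger0_norm// ltr_pM2l.
Qed.

Lemma approximable_dilate phi psi (j n : nat) x : phi (2 ^ j * n)%N = psi n ->
  approximable phi (2 ^ j * n) x -> approximable psi n (2 ^+ j * x).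
Proof.
move=> pE [m mn mx]; exists m.
  by move: mn; rewrite PoszM coprimezMr => /andP[].
by rewrite -pE -natrX mulrAC -natrM mulrC.
Qed.

Lemma approximable_le psi phi n : psi n <= phi n ->
  approximable psi n `<=` approximable phi n.
Proof. by move=> pp x [m mn mx]; exists m => //; exact: lt_le_trans pp. Qed.

Lemma limsup_map psi phi x y :
  (forall n, (0 < n)%N -> approximable psi n x -> approximable phi n y) ->
  lim_sup_set (approximable psi) x -> lim_sup_set (approximable phi) y.
Proof.
move=> H Lx m _; have [n /= mn nx] := Lx m.+1 I.
by exists n => /=; [exact: ltnW|apply: H => //; exact: leq_ltn_trans mn].
Qed.

Lemma limsup1 psi x : lim_sup_set (approximable psi) (x + 1) <->
  lim_sup_set (approximable psi) x.
Proof. by split; apply: limsup_map => n n0 /approximable1; exact. Qed.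

End approximable_maps.

(** * Partial sums and divergence of subseries *)

Section partial_sums.
Context {R : realType}.
Implicit Types (psi phi : nat -> R) (n m M : nat).

Definition partial_DS psi M : R := \sum_(1 <= n < M) psi n * (totient n)%:R / n%:R.

(** Since [approximable] uses a strict inequality, the value 0 gives an empty set: restricting
    discards the denominators outside P. *)
Definition restrict (P : pred nat) psi n : R := if P n then psi n else 0.

Definition nonneg psi := forall n, (1 <= n)%N -> 0 <= psi n.

Lemma restrict_nonneg P psi : nonneg psi -> nonneg (restrict P psi).
Proof. by move=> p0 n n0; rewrite /restrict; case: ifP => // _; exact: p0. Qed.

Lemma restrict_le P psi n : 0 <= psi n -> restrict P psi n <= psi n.
Proof. by rewrite /restrict; case: ifP. Qed.

Lemma restrict_approximable P psi n x : approximable (restrict P psi) n x ->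
  P n /\ approximable psi n x.
Proof.
case=> m mn; rewrite /restrict; case: ifP => [Pn mx|_]; first by split=> //; exists m.
by rewrite normr_lt0.
Qed.

Lemma DS_term_ge0 psi n : nonneg psi -> (1 <= n)%N ->
  0 <= psi n * (totient n)%:R / n%:R.
Proof. by move=> p0 n0; rewrite !mulr_ge0// ?invr_ge0// p0. Qed.

Lemma partial_DS_le psi M : nonneg psi -> ((partial_DS psi M)%:E <= DS_sum psi)%E.
Proof.
move=> p0; rewrite /partial_DS -sumEFin; apply: nneseries_lim_ge => n n0 _.
by rewrite lee_fin; exact: DS_term_ge0.
Qed.

Lemma DS_sum_le psi (c : \bar R) : nonneg psi ->
  (forall M, ((partial_DS psi M)%:E <= c)%E) -> (DS_sum psi <= c)%E.
Proof.
move=> p0 H; apply: lime_le.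
  by apply: is_cvg_nneseries => n n0 _; rewrite lee_fin; exact: DS_term_ge0.
by apply: nearW => M; rewrite sumEFin; exact: H.
Qed.

Lemma lt_DS_sum psi (c : R) : nonneg psi -> (c%:E < DS_sum psi)%E ->
  exists M, c < partial_DS psi M.
Proof.
move=> p0 H; apply: contrapT => nM; move: H; apply/negP; rewrite -leNgt.
apply: DS_sum_le => // M; rewrite lee_fin leNgt; apply/negP => cM.
by apply: nM; exists M.
Qed.

Lemma DS_sum_pinfty psi : nonneg psi -> (forall c : R, exists M, c <= partial_DS psi M) ->
  DS_sum psi = +oo%E.
Proof.
move=> p0 H; apply/eqyP => c _; have [M cM] := H c.
by apply: le_trans (partial_DS_le M p0); rewrite lee_fin.
Qed.

Lemma partial_DSD psi phi M : partial_DS (fun n => psi n + phi n) M =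
  partial_DS psi M + partial_DS phi M.
Proof. by rewrite -big_split/=; apply: eq_bigr => n _; rewrite -!mulrA mulrDl. Qed.

Lemma partial_DSZ c psi M : partial_DS (fun n => c * psi n) M = c * partial_DS psi M.
Proof. by rewrite mulr_sumr; apply: eq_bigr => n _; rewrite -!mulrA. Qed.

Lemma partial_DS_mono psi M N : nonneg psi -> (M <= N)%N ->
  partial_DS psi M <= partial_DS psi N.
Proof.
move=> p0 MN; have [M1|M1] := leqP M 1.
  by rewrite /partial_DS big_geq// big_nat sumr_ge0// => n /andP[n0 _]; exact: DS_term_ge0.
rewrite /partial_DS [leRHS](big_cat_nat _ (n := M))//=; last exact: ltnW.
rewrite lerDl big_nat sumr_ge0// => n /andP[n0 _]; apply: DS_term_ge0 => //.
by apply: leq_trans n0; exact: ltnW.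
Qed.

Lemma DS_sumZ c psi : 0 < c -> nonneg psi -> DS_sum psi = +oo%E ->
  DS_sum (fun n => c * psi n) = +oo%E.
Proof.
move=> c0 p0 poo; apply: DS_sum_pinfty => [n n0|d].
  by rewrite mulr_ge0 ?p0// ltW.
have [|M /ltW dM] := @lt_DS_sum psi (d / c) p0; first by rewrite poo ltry.
by exists M; rewrite partial_DSZ mulrC -ler_pdivrMr.
Qed.

Lemma DS_sum_restrict P psi : nonneg psi -> DS_sum psi = +oo%E ->
  DS_sum (restrict P psi) = +oo%E \/ DS_sum (restrict (predC P) psi) = +oo%E.
Proof.
move=> p0 poo.
have : (DS_sum psi <= DS_sum (restrict P psi) + DS_sum (restrict (predC P) psi))%E.
  apply: DS_sum_le => // M.
  have -> : partial_DS psi M = partial_DS (restrict P psi) M + partial_DS (restrict (predC P) psi) M.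
    rewrite -partial_DSD; apply: eq_bigr => n _; congr (_ * _ / _).
    by rewrite /restrict/=; case: (P n); rewrite ?addr0 ?add0r.
  by rewrite EFinD leeD// partial_DS_le//; exact: restrict_nonneg.
have := partial_DS_le 0 (restrict_nonneg (predC P) p0).
have := partial_DS_le 0 (restrict_nonneg P p0).
rewrite poo leye_eq; case: (DS_sum (restrict P psi)) => [u| |]//; last by left.
by case: (DS_sum _) => [v| |]//; right.
Qed.

(** The complementary subseries is bounded by a partial sum, so the divergence must come from the
    tail. *)
Lemma DS_sum_tail m psi : nonneg psi -> DS_sum psi = +oo%E ->
  DS_sum (restrict (fun n => m <= n)%N psi) = +oo%E.
Proof.
move=> p0 poo; have [//|] := DS_sum_restrict (fun n => m <= n)%N p0 poo.
suff : (DS_sum (restrict (predC (fun n => m <= n)%N) psi) <= (partial_DS psi m)%:E)%E.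
  by case: DS_sum => //.
apply: DS_sum_le => [|M]; first exact: restrict_nonneg.
rewrite lee_fin; apply: (@le_trans _ _ (partial_DS (restrict (predC (leq m)) psi) m)).
  have [/partial_DS_mono|mM] := leqP M m; first by apply; exact: restrict_nonneg.
  have [m0|m0] := posnP m.
    by rewrite m0 /partial_DS big1 ?big_geq// => n _; rewrite /restrict/= !mul0r.
  rewrite /partial_DS [leLHS](big_cat_nat _ (n := m))//=; last exact: ltnW.
  rewrite [X in _ + X](_ : _ = 0) ?addr0// big_nat big1// => n /andP[mn _].
  by rewrite /restrict/= mn !mul0r.
apply: ler_sum_nat => n /andP[n0 _]; rewrite -!mulrA; apply: ler_wpM2r; first by rewrite mulr_ge0// invr_ge0.
by apply: restrict_le; exact: p0.
Qed.

End partial_sums.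

(** * From the quantitative bound to full measure *)

Section zero_one.
Context {R : realType}.
Implicit Types (psi phi : nat -> R) (n m M : nat) (C : R).
Local Notation mu := (@lebesgue_measure R).
Local Notation limsup psi := (lim_sup_set (approximable psi)).

Lemma measure_bigcap_itv_ge (F : (set R)^nat) C :
  (forall k, measurable (F k)) -> (forall i j, (i <= j)%N -> F j `<=` F i) ->
  (forall k, (C%:E <= mu (F k `&` `[0%R, 1%R[))%E) ->
  (C%:E <= mu ((\bigcap_k F k) `&` `[0%R, 1%R[))%E.
Proof.
move=> mF dF CF; rewrite -bigcapIl//.
have mFI k : measurable (F k `&` `[0, 1[) by exact: measurableI.
have cF : mu (F k `&` `[0, 1[) @[k --> \oo] --> mu (\bigcap_k (F k `&` `[0, 1[)).
  apply: (nonincreasing_cvg_mu (mu := mu)) => //.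
  - exact: (measure_setI_itv_lty 0 1 (mF 0%N)).
  - exact: bigcapT_measurable.
  - by move=> i j ij; apply/subsetPset => x [Fx x01]; split => //; exact: dF ij _ Fx.
by apply: (cvge_ge _ cF); exact: nearW.
Qed.

Definition quantitative_bound C := forall psi, nonneg psi ->
  (C%:E * Order.min (DS_sum psi) 1 <= circle_measure (union_approx psi))%E.

(** Every tail of the series still diverges, so the minimum in the bound is 1 for each tail union;
    continuity from above passes C to their intersection. *)
Lemma measure_limsup_ge C psi : quantitative_bound C -> nonneg psi ->
  DS_sum psi = +oo%E -> (C%:E <= mu (limsup psi `&` `[0%R, 1%R[))%E.
Proof.
move=> HC p0 poo; apply: measure_bigcap_itv_ge.
- by move=> k; exact: measurable_bigcup_approximable.
- by move=> i j ij x [n /= jn nx]; exists n => //=; exact: leq_trans jn.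
move=> m; have := HC _ (restrict_nonneg (leq m) p0).
rewrite DS_sum_tail// minye mule1 => /le_trans; apply.
rewrite circle_measure_union; apply: le_measure; rewrite ?inE.
- by apply: measurableI => //; exact: measurable_bigcup_approximable.
- by apply: measurableI => //; exact: measurable_bigcup_approximable.
by move=> x [[n /= n0 /restrict_approximable[mn nx]] x01]; split => //; exists n.
Qed.


Lemma limsup_itv_ge_class C psi (k : nat) : quantitative_bound C -> 0 < C -> nonneg psi ->
  (forall n, (0 < n)%N -> psi n != 0 -> (2 ^ k %| n)%N && ~~ (2 ^ k.+1 %| n)%N) ->
  DS_sum psi = +oo%E ->
  forall (j : nat) (a : R), ((C * 2^-1 ^+ j)%:E <= mu (limsup psi `&` `[a, (a + 2^-1 ^+ j)%R[))%E.
Proof.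
move=> HC C0 p0 psik poo j a.
pose phi i n : R := 2^-1 ^+ i * psi n.
have phi0 i : nonneg (phi i).
  by move=> n n0; rewrite /phi mulr_ge0 ?p0// exprn_ge0// invr_ge0.
(* Doubling x doubles psi, which intersecting over all i absorbs: A is mapped
   into itself by x |-> 2 x + 2^-k. *)
pose A := \bigcap_i limsup (phi i).
have mA : measurable A by apply: bigcap_measurable => // i _; exact: measurable_limsup.
have A1 x : A (x + 1) <-> A x.
  by split=> Ax i _; apply/limsup1; exact: Ax.
have A2 x : A x -> A (2 * x + 2^-1 ^+ k).
  move=> Ax i _; apply: limsup_map (Ax i.+1 I) => n n0 nx.
  have /andP[kn nkn] : (2 ^ k %| n)%N && ~~ (2 ^ k.+1 %| n)%N.
    apply: psik => //; apply/negP => /eqP pn; case: nx => m _.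
    by rewrite /phi pn mulr0 normr_lt0.
  apply: approximable_le (approximable_double kn nkn nx).
  by rewrite /phi exprS !mulrA mulfV// mul1r.
(* Scaling by 2^-i preserves divergence, so the same C serves for all i, and it survives the
   decreasing intersection. *)
have CA : (C%:E <= mu (A `&` `[0%R, 1%R[))%E.
  apply: measure_bigcap_itv_ge.
  - by move=> i; exact: measurable_limsup.
  - move=> i l il x; apply: limsup_map => n n0; apply: approximable_le.
    rewrite /phi ler_wpM2r ?p0//; apply: ler_wiXn2l il; lra.
  - move=> i; apply: measure_limsup_ge => //; exact: DS_sumZ.
have [p pE] : exists p, mu (A `&` `[0%R, 1%R[) = p%:E.
  by exists (fine (mu (A `&` `[0, 1[))); rewrite fineK// ge0_fin_numE// measure_setI_itv_lty.
apply: (@le_trans _ _ (mu (A `&` `[a, a + 2^-1 ^+ j[))).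
  rewrite (measure_expanding mA A1 A2 pE) lee_fin ler_wpM2r ?exprn_ge0 ?invr_ge0//.
  by move: CA; rewrite pE lee_fin.
apply: le_measure; rewrite ?inE; [exact: measurableI| |].
  by apply: measurableI => //; exact: measurable_limsup.
move=> x [Ax xa]; split => //; have := Ax 0 I; apply: limsup_map => n _.
by apply: approximable_le; rewrite /phi expr0 mul1r.
Qed.

(** Denominators divisible by 2^(j+1) give a limsup set with periods 2^-i for all i <= j, hence
    equidistributed at scale 2^-j. *)
Lemma limsup_itv_ge_div C psi (j : nat) : quantitative_bound C -> 0 < C -> nonneg psi ->
  DS_sum (restrict (dvdn (2 ^ j.+1)) psi) = +oo%E ->
  forall (a : R), ((C * 2^-1 ^+ j)%:E <= mu (limsup psi `&` `[a, (a + 2^-1 ^+ j)%R[))%E.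
Proof.
move=> HC C0 p0 poo a; set phi := restrict _ _ in poo.
have mA := measurable_limsup phi; set A := limsup phi in mA.
have CA : (C%:E <= mu (A `&` `[0%R, 1%R[))%E.
  by apply: measure_limsup_ge => //; exact: restrict_nonneg.
have [p pE] : exists p, mu (A `&` `[0%R, 1%R[) = p%:E.
  by exists (fine (mu (A `&` `[0, 1[))); rewrite fineK// ge0_fin_numE// measure_setI_itv_lty.
have shift (i : nat) (s : int) x : (i <= j)%N -> A x -> A (x + s%:~R * 2^-1 ^+ i).
  move=> ij; apply: limsup_map => n n0 nx.
  have [jn _] := restrict_approximable nx.
  apply: approximable_shift_pow2 => //; apply: dvdn_trans jn.
  exact: dvdn_exp2l.
have AP (i : nat) x : (i <= j)%N -> A (x + 2^-1 ^+ i) <-> A x.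
  move=> ij; split=> [/(shift i (-1) _ ij)|/(shift i 1 _ ij)]; last by rewrite mul1r.
  by rewrite mulN1r addrK.
apply: (@le_trans _ _ (mu (A `&` `[a, a + 2^-1 ^+ j[))).
  rewrite (measure_periodic_pow2 mA AP pE)// lee_fin ler_wpM2r ?exprn_ge0 ?invr_ge0//.
  by move: CA; rewrite pE lee_fin.
apply: le_measure; rewrite ?inE; [exact: measurableI| |].
  by apply: measurableI => //; exact: measurable_limsup.
by move=> x [Ax xa]; split => //; apply: limsup_map Ax => n _ /restrict_approximable[].
Qed.

Lemma limsup_itv_ge C psi : quantitative_bound C -> 0 < C -> nonneg psi ->
  DS_sum psi = +oo%E ->
  forall (j : nat) (a : R), ((C * 2^-1 ^+ j)%:E <= mu (limsup psi `&` `[a, (a + 2^-1 ^+ j)%R[))%E.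
Proof.
move=> HC C0 p0 poo.
pose class k : pred nat := fun n => (2 ^ k %| n)%N && ~~ (2 ^ k.+1 %| n)%N.
have [[k koo]|nclass] := pselect (exists k, DS_sum (restrict (class k) psi) = +oo%E).
  move=> j a; apply: (@le_trans _ _ (mu (limsup (restrict (class k) psi) `&` `[a, a + 2^-1 ^+ j[))).
    apply: (@limsup_itv_ge_class _ _ k) => //; first exact: restrict_nonneg.
    by move=> n n0; rewrite /restrict; case: ifP => //; rewrite eqxx.
  apply: le_measure; rewrite ?inE.
  - by apply: measurableI => //; exact: measurable_limsup.
  - by apply: measurableI => //; exact: measurable_limsup.
  by move=> x [Ax xa]; split => //; apply: limsup_map Ax => n _ /restrict_approximable[].
(* The multiples of 2^k split into the class k, whose series converges here, and the multiples of
   2^(k+1), which inherit the divergence. *)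
have dvdoo k : DS_sum (restrict (dvdn (2 ^ k)) psi) = +oo%E.
  elim: k => [|k IH].
    by rewrite -[RHS]poo; congr DS_sum; apply/funext => n; rewrite /restrict dvd1n.
  have [|noo] := DS_sum_restrict (dvdn (2 ^ k.+1)) (restrict_nonneg _ p0) IH.
    suff -> : restrict (dvdn (2 ^ k.+1)) (restrict (dvdn (2 ^ k)) psi) =
      restrict (dvdn (2 ^ k.+1)) psi by [].
    apply/funext => n; rewrite /restrict; case: ifP => // kn.
    by rewrite (dvdn_trans _ kn)// dvdn_exp2l.
  case: nclass; exists k; rewrite -[RHS]noo; congr DS_sum; apply/funext => n.
  by rewrite /restrict /class /=; case: (2 ^ k.+1 %| n)%N; rewrite ?andbF ?andbT.
by move=> j a; exact: limsup_itv_ge_div.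
Qed.

Lemma duffin_schaeffer_of_quantitative C psi : quantitative_bound C -> 0 < C -> nonneg psi ->
  DS_sum psi = +oo%E -> circle_measure (limsup_approx psi) = 1%E.
Proof.
move=> HC C0 p0 poo; rewrite circle_measure_limsup.
apply: (@measure_full_density R _ C) => //; first exact: measurable_limsup.
exact: limsup_itv_ge.
Qed.

End zero_one.

(** * Dilation by powers of 2 and blocks of small measure *)

Lemma leq_totient_mul_pow2 (j n : nat) : (0 < n)%N ->
  (2 ^ j * totient n <= 2 * totient (2 ^ j * n))%N.
Proof.
move=> n0; have [m m2 nE] := pfactor_coprime (isT : prime 2) n0.
move: (logn 2 n) nE => v ->.
rewrite (mulnCA (2 ^ j)%N) -expnD !totient_coprime ?coprimeXr// 1?coprime_sym//.
(* For even n, totient (2^j * n) equals 2^j * totient n. The factor 2 is lost only for odd n and j >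
   0, where the exponent of 2 drops to j - 1. *)
case: v => [|v]; last first.
  by rewrite addnS !totient_pfactor// expnD /=; nia.
case: j => [|j]; first by rewrite !expn0 mul1n leq_pmull.
by rewrite addn0 (@totient_pfactor 2 j.+1)// (_ : totient 1 = 1)%N// expnS /=; nia.
Qed.

Section dilation.
Context {R : realType}.
Implicit Types (psi phi : nat -> R) (n m M N : nat).
Local Notation mu := (@lebesgue_measure R).
Local Notation approx_union psi :=
  (\bigcup_(n in [set n : nat | (1 <= n)%N]) approximable psi n).

Definition dilate j psi n : R := if (2 ^ j %| n)%N then psi (n %/ 2 ^ j)%N else 0.

Lemma dilateE j psi n : dilate j psi (2 ^ j * n)%N = psi n.
Proof. by rewrite /dilate dvdn_mulr// mulKn// expn_gt0. Qed.

Lemma dilate_nonneg j psi : nonneg psi -> nonneg (dilate j psi).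
Proof.
move=> p0 n n0; rewrite /dilate; case: ifP => // jn; apply: p0.
by rewrite divn_gt0 ?expn_gt0// dvdn_leq.
Qed.

(** The term of [psi] at n is compared with the term of its dilation at 2^j * n; the 2 comes from
    [leq_totient_mul_pow2]. *)
Lemma partial_DS_dilate j psi M : nonneg psi ->
  partial_DS psi M <= 2 * partial_DS (dilate j psi) (2 ^ j * M).
Proof.
move=> p0; elim: M => [|M IH].
  by rewrite /partial_DS big_geq// muln0 big_geq ?mulr0.
have [->|M0] := posnP M.
  rewrite {1}/partial_DS big_geq// mulr_ge0// /partial_DS big_nat sumr_ge0// => n /andP[n0 _].
  by apply: DS_term_ge0 => //; exact: dilate_nonneg.
have j0 : (0 < 2 ^ j)%N by rewrite expn_gt0.
have jM : (0 < 2 ^ j * M)%N by rewrite muln_gt0 j0.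
apply: (@le_trans _ _ (2 * partial_DS (dilate j psi) (2 ^ j * M).+1)); last first.
  rewrite ler_pM2l//; apply: partial_DS_mono; first exact: dilate_nonneg.
  by rewrite mulnS -addn1 addnC leq_add2r.
rewrite /partial_DS !big_nat_recr//= mulrDr lerD// dilateE.
have jr : 0 < (2 ^ j)%:R :> R by rewrite ltr0n.
have Mr : 0 < M%:R :> R by rewrite ltr0n.
have -> : 2 * (psi M * (totient (2 ^ j * M))%:R / (2 ^ j * M)%:R) =
    psi M * ((2 * (totient (2 ^ j * M))%:R) / (2 ^ j)%:R) / M%:R.
  by rewrite natrM; field; rewrite !gt_eqF.
rewrite ler_pM2r ?invr_gt0//; apply: ler_wpM2l; first exact: p0.
by rewrite ler_pdivlMr// mulrC -!natrM ler_nat leq_totient_mul_pow2.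
Qed.

(** Multiplication by 2^j preserves measure on the circle and carries the union for the dilation
    into the union for [psi]. *)
Lemma approx_union_dilate j psi : nonneg psi ->
  (mu (approx_union (dilate j psi) `&` `[0%R, 1%R[) <= mu (approx_union psi `&` `[0%R, 1%R[))%E.
Proof.
move=> p0; have mU := measurable_bigcup_approximable psi [set n : nat | (1 <= n)%N].
rewrite -(@measure_pow2 R _ j mU); last first.
  by move=> x; split=> -[n n0 nx]; exists n => //; apply/approximable1.
apply: le_measure; rewrite ?inE.
- by apply: measurableI => //; exact: measurable_bigcup_approximable.
- by apply: measurableI => //; exact: (measurable_preimage_mul _ mU).
move=> x [[n /= n0 nx] x01]; split => //=.
have [jn|jn] := boolP (2 ^ j %| n)%N; last first.
  by case: nx => m _; rewrite /dilate (negbTE jn) normr_lt0.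
move: nx n0; rewrite -(divnK jn) mulnC => nx n0.
exists (n %/ 2 ^ j)%N; first by rewrite /= divn_gt0 ?expn_gt0// dvdn_leq// -(divnK jn) mulnC.
by apply: approximable_dilate nx; exact: dilateE.
Qed.

Definition supported_in N M psi := forall n, psi n != 0 -> (N <= n < M)%N.

(** Copies of a truncation of [psi] are added one at a time, each dilated far enough to start beyond
    the previous ones. Every copy adds at least half of the partial sum and at most e of measure. *)
Lemma disjoint_copies psi (e : R) M0 : nonneg psi ->
  (mu (approx_union psi `&` `[0%R, 1%R[) <= e%:E)%E ->
  forall K N, exists phi M, [/\ nonneg phi, supported_in N M phi, (N <= M)%N,
    K%:R * (partial_DS psi M0 / 2) <= partial_DS phi M &
    (mu (approx_union phi `&` `[0%R, 1%R[) <= (K%:R * e)%:E)%E].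
Proof.
move=> p0 pe.
pose psi1 := restrict (fun n => 0 < n < M0)%N psi.
have psi10 : nonneg psi1 by exact: restrict_nonneg.
have psi1e : (mu (approx_union psi1 `&` `[0%R, 1%R[) <= e%:E)%E.
  apply: le_trans pe; apply: le_measure; rewrite ?inE.
  - by apply: measurableI => //; exact: measurable_bigcup_approximable.
  - by apply: measurableI => //; exact: measurable_bigcup_approximable.
  by move=> x [[n n0 /restrict_approximable[_ nx]] x01]; split => //; exists n.
have psi1S : partial_DS psi1 M0 = partial_DS psi M0.
  by rewrite /partial_DS; apply: eq_big_nat => n nM; rewrite /psi1 /restrict nM.
elim=> [|K IH] N.
  exists (fun=> 0), N; split => //.
  - by move=> n; rewrite eqxx.
  - by rewrite mul0r /partial_DS big1// => n _; rewrite !mul0r.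
  - rewrite mul0r [X in mu X](_ : _ = set0) ?measure0//.
    by apply/seteqP; split => x // [[n _ [m _]]]; rewrite normr_lt0.
have [phi [M [phi0 phiNM NM phiS phie]]] := IH N.
(* The exponent M suffices: the support of d starts at 2^M or later, and 2^M > M. *)
pose d := dilate M psi1.
have d0 : nonneg d by exact: dilate_nonneg.
have dsupp n : d n != 0 -> (2 ^ M <= n < 2 ^ M * M0)%N.
  rewrite /d /dilate; case: ifP => [Mn|]; last by rewrite eqxx.
  rewrite /psi1 /restrict; case: ifP => [/andP[n0 nM] _|]; last by rewrite eqxx.
  rewrite -{1}(divnK Mn) leq_pmull//= -(divnK Mn) mulnC ltn_pmul2l// expn_gt0//.
have MM : (M < 2 ^ M)%N by exact: ltn_expl.
have disj n : phi n = 0 \/ d n = 0.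
  have [->|/phiNM/andP[_ nM]] := eqVneq (phi n) 0; first by left.
  right; apply/eqP; apply: contraTT nM => /dsupp/andP[Mn _].
  by rewrite -leqNgt; exact: leq_trans (ltnW MM) Mn.
exists (fun n => phi n + d n), (maxn M (2 ^ M * M0)); split.
- by move=> n n0; rewrite addr_ge0// ?phi0// d0.
- move=> n; have [->|pn] := eqVneq (phi n) 0.
    rewrite add0r => /dsupp/andP[Mn nM]; rewrite leq_max nM orbT andbT.
    exact: leq_trans NM (leq_trans (ltnW MM) Mn).
  by move=> _; have /andP[-> nM] := phiNM _ pn; rewrite leq_max nM.
- by rewrite leq_max NM.
- rewrite partial_DSD -natr1 mulrDl mul1r; apply: lerD.
    by apply: le_trans phiS _; exact: partial_DS_mono (leq_maxl _ _).
  rewrite -psi1S ler_pdivrMr// mulrC.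
  apply: le_trans (partial_DS_dilate M M0 psi10) _; rewrite ler_pM2l//.
  exact: partial_DS_mono (leq_maxr _ _).
- have mU (f : nat -> R) : measurable (approx_union f `&` `[0, 1[).
    by apply: measurableI => //; exact: measurable_bigcup_approximable.
  apply: (@le_trans _ _ (mu ((approx_union phi `&` `[0, 1[) `|` (approx_union d `&` `[0, 1[)))).
    apply: le_measure; rewrite ?inE; [exact: mU|by apply: measurableU; exact: mU|].
    move=> x [[n n0 nx] x01].
    have [E|E] := disj n; [right|left]; split => //; exists n => //;
      by case: nx => m mn; rewrite E ?add0r ?addr0; exists m.
  apply: le_trans (measureU2 mu (mU phi) (mU d)) _.
  rewrite -natr1 mulrDl mul1r EFinD; apply: leeD => //.
  exact: le_trans (approx_union_dilate M psi10) psi1e.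
Qed.

Lemma cheap_block (eps : R) N : 0 < eps ->
  (forall C : R, 0 < C -> ~ quantitative_bound C) ->
  exists phi M, [/\ nonneg phi, supported_in N M phi, (N <= M)%N,
    1 / 4 <= partial_DS phi M &
    (mu (approx_union phi `&` `[0%R, 1%R[) <= eps%:E)%E].
Proof.
move=> eps0 /(_ (eps / 2)) nq.
have e20 : 0 < eps / 2 by rewrite divr_gt0.
have [psi [p0 pU]] : exists psi : nat -> R, nonneg psi /\
    (circle_measure (union_approx psi) < (eps / 2)%:E * Order.min (DS_sum psi) 1)%E.
  apply: contrapT => H; apply: (nq e20) => psi p0; rewrite leNgt; apply/negP => pU.
  by apply: H; exists psi.
rewrite circle_measure_union in pU.
have DS0 : (0 <= DS_sum psi)%E.
  by have := partial_DS_le 0 p0; rewrite /partial_DS big_geq.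
have [s sE] : exists s, Order.min (DS_sum psi) 1%E = s%:E.
  case: (DS_sum psi) DS0 => [r| |]// _; last by exists 1; rewrite minye.
  by exists (Order.min r 1); rewrite EFin_min.
rewrite sE in pU.
have s0 : 0 < s.
  have := le_lt_trans (measure_ge0 mu _) pU.
  by rewrite -EFinM lte_fin pmulr_rgt0.
have s1 : s <= 1 by rewrite -lee_fin -sE ge_min lexx orbT.
have sDS : (s%:E <= DS_sum psi)%E by rewrite -sE ge_min lexx.
have [|M0 sM0] := @lt_DS_sum _ psi (s / 2) p0.
  by apply: lt_le_trans sDS; rewrite lte_fin; lra.
(* Each copy has mass at least s / 4, one half being lost in the partial sum and one in the
   dilation. As 1 <= K * s <= 2, the total mass is at least 1 / 4 and the measure at most 2 * (eps /
   2). *)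
pose K := (Num.truncn s^-1).+1.
have [K1 K2] : s^-1 < K%:R /\ K%:R <= s^-1 + 1.
  have := truncn_itv (ltW (_ : 0 < s^-1)); rewrite invr_gt0 => /(_ s0) /andP[h1 h2].
  by split => //; rewrite /K -natr1 lerD2r.
have K1s : 1 <= K%:R * s by rewrite -ler_pdivrMr// mul1r ltW.
have K2s : K%:R * s <= 2.
  apply: (@le_trans _ _ ((s^-1 + 1) * s)); first by rewrite ler_pM2r.
  by rewrite mulrDl mulVf ?gt_eqF// mul1r; lra.
rewrite -EFinM in pU.
have [phi [M [h1 h2 h3 h4 h5]]] := disjoint_copies M0 p0 (ltW pU) K N.
exists phi, M; split => //.
  apply: le_trans h4; apply: (@le_trans _ _ (K%:R * (s / 2 / 2))).
    by rewrite !mulrA; lra.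
  by rewrite ler_wpM2l// ler_pM2r ?invr_gt0// ltW.
apply: le_trans h5 _; rewrite lee_fin.
have -> : K%:R * (eps / 2 * s) = (K%:R * s) * (eps / 2) by ring.
by apply: (@le_trans _ _ (2 * (eps / 2))); [rewrite ler_pM2r|lra].
Qed.

End dilation.

(** * Concatenating blocks: from full measure to the quantitative bound *)

Section concatenation.
Context {R : realType}.
Implicit Types (psi phi : nat -> R) (n m M N : nat).
Local Notation mu := (@lebesgue_measure R).
Local Notation limsup psi := (lim_sup_set (approximable psi)).
Local Notation approx_union psi :=
  (\bigcup_(n in [set n : nat | (1 <= n)%N]) approximable psi n).

Lemma cheap_block_sequence : (forall C : R, 0 < C -> ~ quantitative_bound C) ->
  exists (phi : nat -> nat -> R) (N : nat -> nat),
    [/\ forall k, (k < N k)%N, forall k, (N k <= N k.+1)%N,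
      forall k, nonneg (phi k), forall k, supported_in (N k) (N k.+1) (phi k) &
      forall k, 1 / 4 <= partial_DS (phi k) (N k.+1) /\
       (mu (approx_union (phi k) `&` `[0%R, 1%R[) <= (1 / (2 ^ (k + 1))%:R)%:E)%E].
Proof.
move=> nq; pose good (kN : nat * nat) (fM : (nat -> R) * nat) :=
  [/\ nonneg fM.1, supported_in kN.2 fM.2 fM.1, (kN.2 <= fM.2)%N,
    1 / 4 <= partial_DS fM.1 fM.2 &
    (mu (approx_union fM.1 `&` `[0%R, 1%R[) <= (1 / (2 ^ (kN.1 + 1))%:R)%:E)%E].
have /choice[g gP] : forall kN, exists fM, good kN fM.
  move=> [k N].
  have [|f [M [h1 h2 h3 h4 h5]]] := @cheap_block R (1 / (2 ^ (k + 1))%:R) N _ nq.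
    by rewrite divr_gt0// ltr0n expn_gt0.
  by exists (f, M).
(* Each block starts after the end of the previous one; the start at 1 and the successor give k < N
   k. *)
pose fix N k := if k is k'.+1 then (g (k', N k')).2.+1 else 1%N.
have gN k := gP (k, N k).
exists (fun k => (g (k, N k)).1), N; split.
- by elim=> // k IH; have [_ _ h _ _] := gN k; rewrite ltnS; exact: leq_trans IH h.
- by move=> k; have [_ _ h _ _] := gN k; exact: leqW.
- by move=> k; have [] := gN k.
- move=> k n; have [_ h _ _ _] := gN k => /h /andP[-> /=]; exact: leqW.
- move=> k; have [h1 _ _ h4 h5] := gN k; split=> //.
  by apply: le_trans h4 _; exact: partial_DS_mono.
Qed.

Lemma quantitative_of_duffin_schaeffer :
  (forall psi, nonneg psi -> DS_sum psi = +oo%E ->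
     circle_measure (limsup_approx psi) = 1%E) ->
  exists C : R, 0 < C /\ quantitative_bound C.
Proof.
move=> DS; apply: contrapT => nex.
have [|phi [N [kN NN phi0 phiN phiP]]] := cheap_block_sequence.
  by move=> C C0 qC; apply: nex; exists C.
have Nmono : {homo N : i j / (i <= j)%N} by exact: homo_leq leqnn leq_trans NN.
(* The blocks have disjoint supports, so at each n at most one of them is
   nonzero, and its index is below n because k < N k. *)
pose psi n := \sum_(0 <= k < n) phi k n.
have psi0 : nonneg psi by move=> n n0; apply: sumr_ge0 => k _; exact: phi0.
have psi_block n x : approximable psi n x ->
    exists k, (n < N k.+1)%N /\ approximable (phi k) n x.
  move=> nx; have [k [kn pk]] : exists k, (k < n)%N /\ phi k n != 0.
    apply: contrapT => nk; case: nx => m _.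
    rewrite /psi big_nat big1 ?normr_lt0// => k /andP[_ kn].
    by apply: contrapT => /eqP pk; apply: nk; exists k.
  exists k; have /andP[kn1 kn2] := phiN k n pk; split => //.
  suff psiE : psi n = phi k n by case: nx => m mn; rewrite psiE; exists m.
  rewrite /psi big_mkord (bigD1 (Ordinal kn))//= big1 ?addr0// => i ik.
  apply/eqP; apply: contraNT ik => /phiN/andP[in1 in2]; apply/eqP/val_inj => /=.
  case: (ltngtP i k) => // ik.
    by have := leq_trans in2 (leq_trans (Nmono _ _ ik) kn1); rewrite ltnn.
  by have := leq_trans kn2 (leq_trans (Nmono _ _ ik) in1); rewrite ltnn.
have psi_ge K n : (1 <= n)%N -> \sum_(0 <= k < K) phi k n <= psi n.
  move=> n0; rewrite /psi; have [Kn|nK] := leqP K n.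
    rewrite [leRHS](big_cat_nat _ (n := K))//= lerDl; apply: sumr_ge0 => k _.
    exact: phi0.
  rewrite [leLHS](big_cat_nat _ (n := n))//=; last exact: ltnW.
  rewrite [X in _ + X](_ : _ = 0) ?addr0// big_nat big1// => k /andP[nk _].
  apply: contrapT => /eqP /phiN/andP[kn _].
  by have := leq_trans (kN k) (leq_trans kn nk); rewrite ltnn.
have psioo : DS_sum psi = +oo%E.
  (* The first K blocks end before N K and contribute at least 1 / 4 each, so K > 4 * |c| is
     enough. *)
  apply: DS_sum_pinfty => // c; pose K := (Num.truncn (4 * `|c|)).+1; exists (N K).
  have cK : c <= K%:R * (1 / 4).
    have := ltW (truncnS_gt (4 * `|c|)); rewrite -/K.
    have := ler_norm c; lra.
  apply: (le_trans cK).
  apply: (@le_trans _ _ (\sum_(0 <= k < K) partial_DS (phi k) (N K))).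
    rewrite mulr_natl -[X in _ *+ X]subn0 -sumr_const_nat; apply: ler_sum_nat => k /andP[_ kK].
    apply: le_trans (phiP k).1 _; apply: partial_DS_mono => //; exact: Nmono.
  rewrite /partial_DS exchange_big/=; apply: ler_sum_nat => n /andP[n0 _].
  by rewrite -!mulr_suml -!mulrA ler_wpM2r ?psi_ge// mulr_ge0// invr_ge0.
have := DS psi psi0 psioo; rewrite circle_measure_limsup.
pose F k := approx_union (phi k) `&` `[0, 1[.
have mF k : measurable (F k).
  by apply: measurableI => //; exact: measurable_bigcup_approximable.
suff -> : mu (limsup psi `&` `[0, 1[) = 0 by move=> /eqP; rewrite eqe eq_sym oner_eq0.
(* Borel-Cantelli: the block measures are bounded by the geometric series of 2^-(k+1). *)
have F0 : mu (lim_sup_set F) = 0.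
  apply: lim_sup_set_cvg0 => //.
  apply: (@le_lt_trans _ _ (\sum_(0 <= k <oo) (1 / (2 ^ (k + 1))%:R : R)%:E)%E).
    by apply: lee_nneseries => // k _; exact: (phiP k).2.
  have /cvg_lim -> // := @cvg_geometric_eseries_half R 1 0.
  exact: ltry.
apply/eqP; rewrite eq_le measure_ge0 andbT -F0; apply: le_measure; rewrite ?inE.
- by apply: measurableI => //; exact: measurable_limsup.
- by apply: bigcap_measurable => // k _; apply: bigcup_measurable => j _; exact: mF.
(* A denominator beyond N K can only belong to a block of index at least K, so x lies in infinitely
   many of the sets F k. *)
move=> x [Lx x01] K _; have [n /= Kn nx] := Lx (N K).+1 I.
have [k [nk kx]] := psi_block n x nx.
exists k => /=; last by split => //; exists n => //=; exact: leq_ltn_trans Kn.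
rewrite leqNgt; apply/negP => kK.
by have := leq_ltn_trans (leq_trans (Nmono _ _ kK) (ltnW Kn)) nk; rewrite ltnn.
Qed.

End concatenation.

Theorem theorem1p3 (R : realType) :
  (forall psi : nat -> R,
      (forall n : nat, (1 <= n)%N -> 0 <= psi n) ->
      DS_sum psi = +oo%E ->
      circle_measure (limsup_approx psi) = 1%E)
  <->
  (exists C : R, 0 < C /\
    forall psi : nat -> R,
      (forall n : nat, (1 <= n)%N -> 0 <= psi n) ->
      (C%:E * Order.min (DS_sum psi) 1 <= circle_measure (union_approx psi))%E).
Proof.
split; first exact: quantitative_of_duffin_schaeffer.
by case=> C [C0 HC] psi; exact: duffin_schaeffer_of_quantitative HC C0.
Qed.
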